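(* Let $\oplus_f$ be any binary operation assigning to each pair of programs $(P_1,P_2)$ a program $P_1\oplus_f P_2$. Then the following are equivalent: (BK-6) for all programs $P,P_1,P_2$: if $P_1\equiv_{N_2}P_2$ then $P\oplus_f P_1$ and $P\oplus_f P_2$ have the same answer sets; (BK-0) for all programs $P_1,P_2,R$: if $P_2\vdash_{N_2}R$ then $P_1\oplus_f P_2$ and $P_1\oplus_f(P_2\cup R)$ have the same answer sets.
   Context: Formulas are built from atoms using $\wedge,\vee,\rightarrow,\bot$ and strong negation $\sim$; $\lnot F$ abbreviates $F\rightarrow\bot$. $\mathrm{N}_2$ is intuitionistic propositional logic extended with Nelson's strong-negation axioms ($\sim(\alpha\rightarrow\beta)\leftrightarrow\alpha\wedge\sim\beta$, $\sim(\alpha\wedge\beta)\leftrightarrow\sim\alpha\vee\sim\beta$, $\sim(\alpha\vee\beta)\leftrightarrow\sim\alpha\wedge\sim\beta$, $\alpha\leftrightarrow\sim\sim\alpha$, $\sim\lnot\alpha\leftrightarrow\alpha$, $\sim a\rightarrow\lnot a$ for atoms $a$) and the schema $\alpha\vee(\alpha\rightarrow\beta)\vee\lnot\beta$. For sets of formulas, $T\vdash_{N_2}R$ means $T$ derives every formula of $R$ in $\mathrm{N}_2$, and $T\equiv_{N_2}T'$ means $T\vdash_{N_2}T'$ and $T'\vdash_{N_2}T$. A program is a finite set of formulas $G\rightarrow l$ with $l$ a literal ($a$ or $\sim a$) and $G$ built from literals, $\top,\bot$ by $\wedge,\vee,\lnot$. A consistent set $M$ of literals over the atoms $\mathcal{A}$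 of a program $P$ is an answer set of $P$ iff $P\cup\{\lnot l: l\in Lit_{\mathcal{A}}\setminus M\}\cup\{\lnot\lnot l: l\in M\}$ is $\mathrm{N}_2$-consistent and $\mathrm{N}_2$-derives every literal of $M$. *)

(* Defs.v *)
From HB Require Import structures.
From mathcomp Require Import all_boot finmap.
From mathcomp Require Import classical_sets.

Set Implicit Arguments.
Unset Strict Implicit.
Unset Printing Implicit Defensive.

Local Open Scope fset_scope.
Local Open Scope classical_set_scope.

Inductive formula (A : Type) : Type :=
| Atom of A
| Bot
| And of formula A & formula A
| Or of formula A & formula A
| Imp of formula A & formula A
| SNeg of formula A.

Arguments Bot {A}.

Definition Neg (A : Type) (F : formula A) : formula A := Imp F Bot.
Definition Iff (A : Type) (F G : formula A) : formula A :=
  And (Imp F G) (Imp G F).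

(* Finite sets of formulas require a choiceType, obtained by encoding
   formulas as labelled trees. *)
Fixpoint formula_encode (A : Type) (F : formula A) : GenTree.tree A :=
  match F with
  | Atom a => GenTree.Leaf a
  | Bot => GenTree.Node 0 [::]
  | And G H => GenTree.Node 1 [:: formula_encode G; formula_encode H]
  | Or G H => GenTree.Node 2 [:: formula_encode G; formula_encode H]
  | Imp G H => GenTree.Node 3 [:: formula_encode G; formula_encode H]
  | SNeg G => GenTree.Node 4 [:: formula_encode G]
  end.

Fixpoint formula_decode (A : Type) (t : GenTree.tree A) : option (formula A) :=
  match t with
  | GenTree.Leaf a => Some (Atom a)
  | GenTree.Node 0 [::] => Some Bot
  | GenTree.Node n [:: t1; t2] =>
      match formula_decode t1, formula_decode t2 with
      | Some G, Some H =>
          match n with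
          | 1 => Some (And G H)
          | 2 => Some (Or G H)
          | 3 => Some (Imp G H)
          | _ => None
          end
      | _, _ => None
      end
  | GenTree.Node 4 [:: t1] => omap (@SNeg A) (formula_decode t1)
  | _ => None
  end.

Lemma formula_encodeK (A : Type) :
  pcancel (@formula_encode A) (@formula_decode A).
Proof.
by elim=> [a||G IHG H IHH|G IHG H IHH|G IHG H IHH|G IHG] //=;
  rewrite ?IHG ?IHH.
Qed.

HB.instance Definition _ (A : choiceType) :=
  Choice.copy (formula A) (pcan_type (@formula_encodeK A)).

Inductive N2_axiom (A : Type) : formula A -> Prop :=
| ax_K F G : N2_axiom (Imp F (Imp G F))
| ax_S F G H :
    N2_axiom (Imp (Imp F (Imp G H)) (Imp (Imp F G) (Imp F H)))
| ax_andl F G : N2_axiom (Imp (And F G) F)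
| ax_andr F G : N2_axiom (Imp (And F G) G)
| ax_and F G : N2_axiom (Imp F (Imp G (And F G)))
| ax_orl F G : N2_axiom (Imp F (Or F G))
| ax_orr F G : N2_axiom (Imp G (Or F G))
| ax_or F G H :
    N2_axiom (Imp (Imp F H) (Imp (Imp G H) (Imp (Or F G) H)))
| ax_bot F : N2_axiom (Imp Bot F)
| ax_snegI F G : N2_axiom (Iff (SNeg (Imp F G)) (And F (SNeg G)))
| ax_snegA F G : N2_axiom (Iff (SNeg (And F G)) (Or (SNeg F) (SNeg G)))
| ax_snegO F G : N2_axiom (Iff (SNeg (Or F G)) (And (SNeg F) (SNeg G)))
| ax_snegS F : N2_axiom (Iff F (SNeg (SNeg F)))
| ax_snegN F : N2_axiom (Iff (SNeg (Neg F)) F)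
| ax_snegAtom a : N2_axiom (Imp (SNeg (Atom a)) (Neg (Atom a)))
| ax_HT F G : N2_axiom (Or F (Or (Imp F G) (Neg G))).

Inductive N2_proves (A : Type) (T : set (formula A)) : formula A -> Prop :=
| N2_hyp F : T F -> N2_proves T F
| N2_ax F : N2_axiom F -> N2_proves T F
| N2_mp F G : N2_proves T (Imp F G) -> N2_proves T F -> N2_proves T G.

Definition N2_derives (A : Type) (T R : set (formula A)) : Prop :=
  forall F, R F -> N2_proves T F.

Definition N2_equiv (A : Type) (T T' : set (formula A)) : Prop :=
  N2_derives T T' /\ N2_derives T' T.

Definition N2_consistent (A : Type) (T : set (formula A)) : Prop :=
  ~ N2_proves T Bot.

Definition is_literal (A : Type) (F : formula A) : bool :=
  match F with
  | Atom _ | SNeg (Atom _) => true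
  | _ => false
  end.

(* Implication occurs in a body only as negation [Neg G]; the constant top is
   [Neg Bot], so it needs no case of its own. *)
Fixpoint is_body (A : Type) (F : formula A) : bool :=
  match F with
  | Bot => true
  | And G H | Or G H => is_body G && is_body H
  | Imp G Bot => is_body G
  | _ => is_literal F
  end.

Definition is_rule (A : Type) (F : formula A) : bool :=
  match F with
  | Imp G l => is_body G && is_literal l
  | _ => false
  end.

(* [is_rule] being boolean, programs with the same formulas are equal
   ([val_inj]). *)
Record program (A : choiceType) := Program {
  rules : {fset formula A};
  _ : all (@is_rule A) rules
}.

HB.instance Definition _ (A : choiceType) := [isSub for @rules A].

Definition theory (A : choiceType) (P : program A) : set (formula A) :=
  [set` rules P].

Lemma program_unionP (A : choiceType) (P Q : program A) :
  all (@is_rule A) (rules P `|` rules Q)%fset.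
Proof.
apply/allP=> F; rewrite in_fsetU => /orP[] FPQ.
  exact: (allP (valP P) F FPQ).
exact: (allP (valP Q) F FPQ).
Qed.

Definition program_union (A : choiceType) (P Q : program A) : program A :=
  Program (program_unionP P Q).

Fixpoint formula_atoms (A : choiceType) (F : formula A) : {fset A} :=
  match F with
  | Atom a => [fset a]%fset
  | Bot => fset0
  | And G H | Or G H | Imp G H => (formula_atoms G `|` formula_atoms H)%fset
  | SNeg G => formula_atoms G
  end.

Definition atoms (A : choiceType) (P : program A) : set A :=
  [set a | exists2 F, F \in rules P & a \in formula_atoms F].

Definition literals (A : Type) (B : set A) : set (formula A) :=
  [set l | exists2 a, B a & l = Atom a \/ l = SNeg (Atom a)].

Definition consistent_literals (A : Type) (M : set (formula A)) : Prop :=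
  forall a, ~ (M (Atom a) /\ M (SNeg (Atom a))).

Definition completion (A : choiceType) (P : program A) (M : set (formula A)) :
    set (formula A) :=
  theory P `|` [set Neg l | l in literals (atoms P) `\` M]
           `|` [set Neg (Neg l) | l in M].

Definition answer_set (A : choiceType) (P : program A) (M : set (formula A)) :
    Prop :=
  [/\ M `<=` literals (atoms P), consistent_literals M,
      N2_consistent (completion P M) & N2_derives (completion P M) M].

Definition same_answer_sets (A : choiceType) (P Q : program A) : Prop :=
  forall M : set (formula A), answer_set P M <-> answer_set Q M.

(* Main.v *)
Require Import Defs.
From mathcomp Require Import all_boot finmap.
From mathcomp Require Import classical_sets.

(** Adding derivable rules to a program leaves it $\mathrm{N}_2$-equivalent to itself
    ([N2_equiv_union]), so BK-0 is an instance of BK-6. Conversely, equivalent programs derive each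
    other, so BK-0, used once from each, links both to their union. *)

Lemma N2_derives_hyp (A : Type) (T R : set (formula A)) :
  (forall F, R F -> T F) -> N2_derives T R.
Proof. by move=> sRT F /sRT; apply: N2_hyp. Qed.

Lemma theory_union (A : choiceType) (P Q : program A) F :
  theory (program_union P Q) F <-> theory P F \/ theory Q F.
Proof. by rewrite /theory /= in_fsetU; split=> /orP. Qed.

(** An equality of programs, not just of theories up to equivalence: it can be rewritten under an
    arbitrary [op]. *)
Lemma program_unionC (A : choiceType) (P Q : program A) :
  program_union P Q = program_union Q P.
Proof. by apply: val_inj; rewrite /= fsetUC. Qed.

Lemma N2_equiv_union (A : choiceType) (P R : program A) :
  N2_derives (theory P) (theory R) ->
  N2_equiv (theory P) (theory (program_union P R)).
Proof.
move=> PR; split=> [F /theory_union[PF|/PR//]|]; first exact: N2_hyp.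
by apply: N2_derives_hyp => F PF; apply/theory_union; left.
Qed.

Theorem theorem3p1 (A : choiceType)
    (op : program A -> program A -> program A) :
  (forall P P1 P2 : program A,
      N2_equiv (theory P1) (theory P2) ->
      same_answer_sets (op P P1) (op P P2))
  <->
  (forall P1 P2 R : program A,
      N2_derives (theory P2) (theory R) ->
      same_answer_sets (op P1 P2) (op P1 (program_union P2 R))).
Proof.
split=> [bk6 P1 P2 R P2R|bk0 P P1 P2 [P12 P21] M].
  by apply: bk6; apply: N2_equiv_union.
(* Both sides agree with [op P (P1 `|` P2)]. *)
apply: (iff_trans (bk0 P P1 P2 P12 M)).
(* BK-0 based at [P2] speaks of the union with [P2] first; its premise is [P21]. *)
by rewrite program_unionC; apply: iff_sym; apply: bk0.
Qed.
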